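(* Let $m\ge 1$, let $\tilde z_0,\dots,\tilde z_{m-1}\in\mathbb{T}$ be pairwise distinct, let $\nu_0,\dots,\nu_{m-1}$ be positive integers, put $r=\sum_{k=0}^{m-1}\nu_k$, let $p$ be an integer with $0\le p\le r-1$, and let $\zeta_k^{(l_k)}$, $k=0,\dots,m-1$, $l_k=0,\dots,\nu_k-1$, be complex values. Define, for $k=0,\dots,m-1$ and $l_k=0,\dots,\nu_k-1$, the auxiliary Laurent polynomials $$\ell_{k,l_k}(z)=\frac{(z-\tilde z_k)^{l_k}}{l_k!}\left(\frac{\tilde z_k}{z}\right)^{p}\prod_{j=0,\,j\ne k}^{m-1}\left(\frac{z-\tilde z_j}{\tilde z_k-\tilde z_j}\right)^{\nu_j}\in\Lambda_{-p,\,r+l_k-p-\nu_k},$$ and the generalized fundamental Lagrange–Laurent polynomials $L_{k,l_k}\in\Lambda_{-p,r-p-1}$ by $$L_{k,\nu_k-1}(z)=\ell_{k,\nu_k-1}(z),\qquad k=0,\dots,m-1,$$ and recursively, for $l_k=\nu_k-2,\nu_k-3,\dots,0$, $$L_{k,l_k}(z)=\ell_{k,l_k}(z)-\sum_{s=l_k+1}^{\nu_k-1}\ell_{k,l_k}^{(s)}(\tilde z_k)\,L_{k,s}(z).$$ Then the unique Laurent polynomial $P_m\in\Lambda_{-p,r-p-1}$ satisfying $P_m^{(l_k)}(\tilde z_k)=\zeta_k^{(l_k)}$ for all $k=0,\dots,m-1$ and $l_k=0,\dots,\nu_k-1$ is given by $$P_m(z)=\sum_{k=0}^{m-1}\sum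_{l_k=0}^{\nu_k-1}\zeta_k^{(l_k)}\,L_{k,l_k}(z).$$
   Context: $\mathbb{T}=\{z\in\mathbb{C}:|z|=1\}$. For integers $a\le b$, $\Lambda_{a,b}=\operatorname{span}_{\mathbb{C}}\{z^a,\dots,z^b\}$ (Laurent polynomials with complex coefficients). For a Laurent polynomial $f$, $f^{(s)}$ denotes its $s$-th complex derivative with respect to $z$ (with $f^{(0)}=f$), whereas the superscript in $\zeta_k^{(l_k)}$ is only an index. *)

(* Defs.v *)
From HB Require Import structures.
From mathcomp Require Import all_boot all_order all_algebra.
From mathcomp Require Import complex.
From mathcomp Require Import all_classical all_reals all_analysis.
Set Implicit Arguments.
Unset Strict Implicit.
Unset Printing Implicit Defensive.
Import Order.TTheory GRing.Theory Num.Theory.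
Import numFieldNormedType.Exports.
Local Open Scope ring_scope.

(* The complex numbers. Fixing the numFieldType structure makes the
   derivative derive1n of MathComp-Analysis, for f : CC R -> CC R, the complex
   one: limits of difference quotients with complex increments. *)
Definition CC (R : realType) : numFieldType := R[i]%C.

(* [laurent a b f]: f belongs to span {z^a, ..., z^b} as a function on the
   punctured plane. In Rocq f also has a value at 0, but it is irrelevant: 0 is
   excluded because MathComp sets 0^-1 = 0. *)
Definition laurent (R : realType) (a b : int) (f : CC R -> CC R) : Prop :=
  exists c : int -> CC R, forall z : CC R, z != 0 ->
    f z = \sum_(i < `|b - a|.+1 | a + i%:Z <= b) c (a + i%:Z) * z ^ (a + i%:Z).

Section LagrangeLaurent.
Variables (R : realType) (m : nat).
Variables (zt : 'I_m -> CC R) (nu : 'I_m -> nat) (p : nat).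

Definition ell (k : 'I_m) (l : nat) (z : CC R) : CC R :=
  (z - zt k) ^+ l / l`!%:R * (zt k / z) ^+ p *
  \prod_(j < m | j != k) ((z - zt j) / (zt k - zt j)) ^+ nu j.

(* Lrec n k l is meant for n = nu k - l, the number of recursive unfoldings
   needed at index l; see LE. *)
Fixpoint Lrec (n : nat) (k : 'I_m) (l : nat) (z : CC R) : CC R :=
  if n is n'.+1 then
    ell k l z - \sum_(l.+1 <= s < nu k) derive1n s (ell k l) (zt k) * Lrec n' k s z
  else 0.

Definition L (k : 'I_m) (l : nat) : CC R -> CC R := Lrec (nu k - l) k l.

Lemma Lrec_fuel n n' k l z : (nu k - l <= n)%N -> (nu k - l <= n')%N ->
  (l < nu k)%N -> Lrec n k l z = Lrec n' k l z.
Proof.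
elim: n n' l => [|n IH] [|n'] l //=; rewrite ?leqn0 ?subn_eq0.
- by move=> le1 _; rewrite ltnNge le1.
- by move=> _ le1; rewrite ltnNge le1.
move=> le1 le2 lt; congr (_ - _).
apply: eq_big_nat => s /andP[ls sn]; congr (_ * _).
apply: IH => //.
  by rewrite -ltnS (leq_trans _ le1) // ltn_sub2l.
by rewrite -ltnS (leq_trans _ le2) // ltn_sub2l.
Qed.

Lemma LE k l : (l < nu k)%N -> L k l =
  (fun z => ell k l z -
     \sum_(l.+1 <= s < nu k) derive1n s (ell k l) (zt k) * L k s z).
Proof.
move=> lt; apply/funext => z; rewrite {1}/L.
have [d Ed] : exists d, (nu k - l = d.+1)%N.
  by exists (nu k - l).-1; rewrite prednK // subn_gt0.
rewrite Ed /=; congr (_ - _).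
apply: eq_big_nat => s /andP[ls sn]; congr (_ * _).
by apply: Lrec_fuel => //; rewrite -ltnS -Ed ltn_sub2l.
Qed.

Lemma L_last k : (0 < nu k)%N -> L k (nu k).-1 = ell k (nu k).-1.
Proof.
move=> nu_gt0; rewrite LE ?prednK //; apply/funext => z.
by rewrite big_geq ?prednK // subr0.
Qed.

Definition interpolates (zeta : forall k : 'I_m, 'I_(nu k) -> CC R)
    (f : CC R -> CC R) : Prop :=
  forall (k : 'I_m) (l : 'I_(nu k)), derive1n l f (zt k) = zeta k l.

Definition P_m (zeta : forall k : 'I_m, 'I_(nu k) -> CC R) (z : CC R) : CC R :=
  \sum_(k < m) \sum_(l < nu k) zeta k l * L k l z.

End LagrangeLaurent.

(* Main.v *)
Require Import Defs.
From HB Require Import structures.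
From mathcomp Require Import all_boot all_order all_algebra.
From mathcomp Require Import complex.
From mathcomp Require Import all_classical all_reals all_analysis.
From mathcomp Require Import ring.
Set Implicit Arguments.
Unset Strict Implicit.
Unset Printing Implicit Defensive.
Import Order.TTheory GRing.Theory Num.Theory.
Import numFieldNormedType.Exports.
Local Open Scope ring_scope.

(** Away from 0, a Laurent polynomial whose pole at 0 has order at most d is
    f = q / z ^ d with q a polynomial, and its derivatives are again of this
    kind:
        (q / z ^ d)' = (X q' - d q) / z ^ (d + 1).
    Iterating this on q = (X - a) ^ n * h, and evaluating at a, only the terms
    that differentiate the factor (X - a) each time survive, so that
        f^(n) a = n! h(a) / a ^ d            (frac_poly_derive1n_at_zero).
    Hence, for a != 0, the first n derivatives of f (from order 0) vanish at a
    exactly when (X - a) ^ n divides q (dvdp_exp_XsubCP). This turns the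
    Hermite conditions at the nodes into divisibility of the numerator.

    Uniqueness: the difference of two solutions has a numerator of degree less
    than r, divisible by the pairwise coprime (X - z_k) ^ nu_k, whose product
    has degree r; so it is 0 (laurent_poly_uniq).

    Existence: ell_(k,l) vanishes to order nu_j at each node z_j other than
    z_k. At z_k it vanishes to order l, and its l-th derivative is 1 because
    its cofactor (z_k / z) ^ p * \prod ... equals 1 there. Only the derivatives
    of order s with l < s < nu_k at z_k are uncontrolled, and subtracting
    ell_(k,l)^(s)(z_k) L_(k,s) removes them, provided that the L_(k,s) with
    s > l already have all their derivatives at the nodes equal to 0 except
    the s-th one at z_k, equal to 1. So downward induction on l gives
        L_(k,l)^(s)(z_j) = 1 if (j, s) = (k, l), and 0 otherwise
    (L_laurent_poly), from which P_m interpolates by linearity of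
    differentiation. *)

(** * Polynomials and their zeros *)

Section PolynomialZeros.
Variables (F : fieldType) (m : nat) (x : 'I_m -> F) (nu : 'I_m -> nat).

Lemma size_prod_exp_XsubC (P : pred 'I_m) :
  size (\prod_(k < m | P k) ('X - (x k)%:P) ^+ nu k) =
  (\sum_(k < m | P k) nu k).+1.
Proof.
have mon (k : 'I_m) : ('X - (x k)%:P) ^+ nu k \is monic.
  by rewrite monic_exp // monicXsubC.
rewrite size_prod => [|k _]; last exact: monic_neq0.
under eq_bigr do rewrite size_exp_XsubC -addn1.
by rewrite big_split /= sum1_card subSn ?leq_addl // addnK.
Qed.

(** Powers of X - x_k for distinct x_k are coprime, so their product divides q
    as soon as each of them does; its degree exceeds that of q. *)
Lemma poly_eq0_of_zeros (q : {poly F}) : injective x ->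
  (size q <= \sum_(k < m) nu k)%N ->
  (forall k, ('X - (x k)%:P) ^+ nu k %| q) -> q = 0.
Proof.
move=> x_inj szq dvd_q; apply/eqP; apply: contraTT szq => q_neq0.
rewrite -ltnNge -size_prod_exp_XsubC; apply: dvdp_leq => //.
rewrite -big_enum /=.
elim: (enum _) (enum_uniq 'I_m) => [|k s IH] /=.
  by rewrite big_nil dvd1p.
case/andP=> k_notin /IH dvd_s; rewrite big_cons Gauss_dvdp ?dvd_q //.
rewrite big_seq; elim/big_ind: _ => [|u v cu cv|j js].
- exact: coprimep1.
- by rewrite coprimepMr cu cv.
apply/coprimep_expl/coprimep_expr/coprimep_XsubC2.
by rewrite subr_eq0 inj_eq //; apply: contraNneq k_notin => <-.
Qed.

End PolynomialZeros.

(** * Derivatives of the quotients q / z ^ d *)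

Section PolynomialOverPower.
Variable K : numFieldType.
Implicit Types (q h : {poly K}) (f g : K -> K) (a z : K) (d n s : nat).

(** The value at 0 is left free: it affects neither the derivatives at a
    nonzero point nor membership in a space of Laurent polynomials. *)
Definition frac_poly d q f := forall z, z != 0 -> f z = q.[z] / z ^+ d.

(** The numerator of (q / z ^ d)' over z ^ (d + 1). *)
Definition diff_num d q : {poly K} := 'X * q^`() - q *+ d.

(** The numerator of the n-th derivative of q / z ^ d over z ^ (d + n); each
    differentiation raises the exponent of the denominator by one. *)
Fixpoint diffn_num n d q : {poly K} :=
  if n is n'.+1 then diffn_num n' d.+1 (diff_num d q) else q.

Fact diffn_num_is_linear n d : linear (diffn_num n d).
Proof.
elim: n d => [//|n IH] d c q h /=; rewrite -IH; congr (diffn_num _ _ _).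
rewrite /diff_num derivD derivZ mulrDr mulrnDl scalerBr -scalerAr scalerMnr.
by rewrite opprD addrACA.
Qed.

HB.instance Definition _ n d :=
  GRing.isLinear.Build K {poly K} {poly K} _ (diffn_num n d)
    (diffn_num_is_linear n d).

Lemma is_derive_horner q a : is_derive a (1 : K) (horner q) q^`().[a].
Proof.
elim/poly_ind: q => [|q c IH].
  rewrite deriv0 horner0 (_ : horner 0 = cst 0); first exact: is_derive_cst.
  by apply/funext => z; rewrite horner0.
rewrite (_ : horner _ = horner q * id + cst c); last first.
  by apply/funext => z; rewrite !fctE !hornerE.
apply: is_derive_eq.
rewrite derivD derivM derivX derivC !hornerE /= addrC.
by rewrite /GRing.scale /= !mulr1 mulrC.
Qed.

(** The quotient rule applies to f itself because f agrees with q / z ^ d on a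
    neighbourhood of every nonzero point. *)
Lemma frac_poly_derive1 d q f :
  frac_poly d q f -> frac_poly d.+1 (diff_num d q) f^`()%classic.
Proof.
move=> fq a a_neq0; rewrite derive1E.
have near_fq : \near a, (horner q * (fun z => (z ^+ d)^-1)) a = f a.
  near=> z; rewrite fq //.
  by near: z; apply: (@cvgr_neq0 _ _ K (nbhs a) _ id a) => //; exact: cvg_id.
have ad_neq0 : (id ^+ d : K -> K) a != 0 by rewrite fctE expf_neq0.
have dX : is_derive a (1 : K) (id ^+ d : K -> K) ((d%:R * a ^+ d.-1) *: 1).
  exact: is_deriveX.
have dV : is_derive a (1 : K) (fun z => (z ^+ d)^-1)
    (- (a ^+ d) ^- 2 *: ((d%:R * a ^+ d.-1) *: 1)).
  have -> : (fun z => (z ^+ d)^-1) = (fun z => ((id ^+ d : K -> K) z)^-1).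
    by apply/funext => z; rewrite fctE.
  apply: DeriveDef; first exact: derivableV.
  by rewrite deriveV // derive_val fctE.
have := near_eq_is_derive near_fq (is_deriveM (is_derive_horner q a) dV).
case=> _ ->; rewrite /diff_num !hornerE hornerMn /GRing.scale /= mulr1.
rewrite -[q.[a] *+ d]mulr_natl.
(* The derivative of z ^ d carries the truncated exponent d.-1. *)
case: d {fq near_fq ad_neq0 dX dV} => [|d] /=; first by field.
have ad_neq0 : a ^+ d != 0 by rewrite expf_neq0.
by rewrite !exprS; field; rewrite ad_neq0.
Unshelve. all: by end_near. Qed.

Lemma frac_poly_derive1n n d q f :
  frac_poly d q f -> frac_poly (d + n) (diffn_num n d q) f^`(n)%classic.
Proof.
elim: n d q f => [|n IH] d q f fq; first by rewrite addn0.
by rewrite derive1Sn addnS -addSn; exact/IH/frac_poly_derive1.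
Qed.

(** One differentiation replaces (X - a) ^ n.+1 * h by (X - a) ^ n * h1 with
    h1(a) = n.+1 * a * h(a); n of them leave no factor X - a. *)
Lemma diffn_num_at_zero n d h a :
  (diffn_num n d (('X - a%:P) ^+ n * h)).[a] = (n`!%:R * a ^+ n) * h.[a].
Proof.
elim: n d h => [|n IH] d h; first by rewrite !expr0 !mul1r.
have -> : diffn_num n.+1 d (('X - a%:P) ^+ n.+1 * h) = diffn_num n d.+1
    (('X - a%:P) ^+ n * ('X * h *+ n.+1 + ('X - a%:P) * diff_num d h)).
  congr (diffn_num n d.+1 _).
  rewrite /diff_num derivM deriv_exp derivXsubC exprS /=.
  rewrite mul1r mulrnAl -[_ * h *+ n.+1]mulr_natl -['X * h *+ _]mulr_natl.
  rewrite -[_ * h *+ d]mulr_natl -[h *+ d]mulr_natl; move: (h^`()) (_%:R) (_%:R).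
  by move=> h' u v; ring.
rewrite IH factS natrM exprS !hornerE hornerMn !hornerE.
by rewrite subrr mul0r addr0 -[a * _ *+ _]mulr_natl /=; ring.
Qed.

(** Up to the factor n!, the lowest Taylor coefficient of f at a zero a of order
    n of its numerator; when h(a) = 0 the order is higher and it vanishes. *)
Lemma frac_poly_derive1n_at_zero n d h f a : a != 0 ->
  frac_poly d (('X - a%:P) ^+ n * h) f ->
  f^`(n)%classic a = n`!%:R * h.[a] / a ^+ d.
Proof.
move=> a_neq0 /(frac_poly_derive1n n)/(_ a a_neq0) ->.
have [an_neq0 ad_neq0] : a ^+ n != 0 /\ a ^+ d != 0 by rewrite !expf_neq0.
by rewrite diffn_num_at_zero exprD; field; rewrite ad_neq0.
Qed.

(** Vanishing to order n in the analytic sense is divisibility of the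
    numerator. For the converse direction, once q = (X - a) ^ n * h is known,
    the n-th derivative at a is a nonzero multiple of h(a), and its vanishing
    yields one more factor X - a. *)
Lemma dvdp_exp_XsubCP d q f a n : a != 0 -> frac_poly d q f ->
  reflect (forall s, (s < n)%N -> f^`(s)%classic a = 0)
          (('X - a%:P) ^+ n %| q).
Proof.
move=> a_neq0 fq; apply: (iffP idP) => [/dvdpP[h qE] s s_lt_n|].
  have {}qE : q = ('X - a%:P) ^+ s * (('X - a%:P) * (('X - a%:P) ^+ (n - s.+1) * h)).
    by rewrite mulrA mulrA -exprSr -exprD subnKC // mulrC.
  rewrite qE in fq; rewrite (frac_poly_derive1n_at_zero a_neq0 fq).
  by rewrite hornerM hornerXsubC subrr !(mul0r, mulr0).
elim: n => [|n IH] fa0; first by rewrite expr0 dvd1p.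
have /dvdpP[h qE] := IH (fun s s_lt_n => fa0 s (ltnW s_lt_n)).
move: fq (fa0 n (ltnSn n)); rewrite qE mulrC => fq.
rewrite (frac_poly_derive1n_at_zero a_neq0 fq) => /eqP.
rewrite !mulf_eq0 invr_eq0 expf_eq0 (negPf a_neq0) andbF orbF.
rewrite pnatr_eq0 eqn0Ngt fact_gt0 /= => h_root.
by rewrite exprSr dvdp_mul // dvdp_XsubCl /root.
Qed.

(** * Spaces of Laurent polynomials *)

(** The span of z ^ (- d), ..., z ^ (N - d - 1), with N its dimension. *)
Definition laurent_poly d N f :=
  exists2 q : {poly K}, (size q <= N)%N & frac_poly d q f.

Lemma frac_polyD c d q h f g : frac_poly d q f -> frac_poly d h g ->
  frac_poly d (c *: q + h) (fun z => c * f z + g z).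
Proof.
move=> fq gh z z_neq0.
by rewrite fq // gh // hornerD hornerZ mulrDl mulrA.
Qed.

Lemma laurent_polyD c d N f g : laurent_poly d N f -> laurent_poly d N g ->
  laurent_poly d N (fun z => c * f z + g z).
Proof.
move=> [q szq fq] [h szh gh]; exists (c *: q + h); last exact: frac_polyD.
rewrite (leq_trans (size_polyD _ _)) // geq_max szh andbT.
exact: leq_trans (size_scale_leq _ _) szq.
Qed.

Lemma derive1n_laurentD n c d N f g a : a != 0 ->
  laurent_poly d N f -> laurent_poly d N g ->
  (fun z => c * f z + g z)^`(n)%classic a =
  c * f^`(n)%classic a + g^`(n)%classic a.
Proof.
move=> a_neq0 [q _ fq] [h _ gh].
rewrite (frac_poly_derive1n n (frac_polyD c fq gh)) //.
rewrite (frac_poly_derive1n n fq) // (frac_poly_derive1n n gh) //.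
by rewrite linearP hornerD hornerZ mulrDl mulrA.
Qed.

Lemma laurent_polyB d N f g : laurent_poly d N f -> laurent_poly d N g ->
  laurent_poly d N (fun z => f z - g z).
Proof.
move=> fL gL; have := laurent_polyD (-1) gL fL.
by congr laurent_poly; apply/funext => z; rewrite mulN1r addrC.
Qed.

Lemma derive1n_laurentB n d N f g a : a != 0 ->
  laurent_poly d N f -> laurent_poly d N g ->
  (fun z => f z - g z)^`(n)%classic a = f^`(n)%classic a - g^`(n)%classic a.
Proof.
move=> a_neq0 fL gL; rewrite addrC -mulN1r -(derive1n_laurentD n _ a_neq0 gL fL).
by congr (_^`(n)%classic a); apply/funext => z; rewrite mulN1r addrC.
Qed.

Lemma laurent_poly_sum (I : eqType) (r : seq I) d N c (f : I -> K -> K) :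
  (forall i, i \in r -> laurent_poly d N (f i)) ->
  laurent_poly d N (fun z => \sum_(i <- r) c i * f i z).
Proof.
elim: r => [|i r IH] fL.
  by exists 0 => [|z _]; rewrite ?size_poly0 // big_nil horner0 mul0r.
under [X in laurent_poly _ _ X]funext do rewrite big_cons.
apply: laurent_polyD; first exact/fL/mem_head.
by apply: IH => j jr; apply: fL; rewrite in_cons jr orbT.
Qed.

Lemma derive1n_laurent_sum (I : eqType) (r : seq I) n d N c (f : I -> K -> K) a :
  a != 0 -> (forall i, i \in r -> laurent_poly d N (f i)) ->
  (fun z => \sum_(i <- r) c i * f i z)^`(n)%classic a =
  \sum_(i <- r) c i * (f i)^`(n)%classic a.
Proof.
move=> a_neq0; elim: r => [|i r IH] fL.
  rewrite (@frac_poly_derive1n n d 0) // => [|z _]; rewrite big_nil.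
    by rewrite linear0 horner0 mul0r.
  by rewrite horner0 mul0r.
have fL' j : j \in r -> laurent_poly d N (f j).
  by move=> jr; apply: fL; rewrite in_cons jr orbT.
under [X in X^`(n)%classic]funext do rewrite big_cons.
rewrite (derive1n_laurentD n _ a_neq0 (fL i (mem_head _ _)) (laurent_poly_sum c fL')).
by rewrite IH // big_cons.
Qed.

(** Uniqueness of Hermite interpolation: the number of conditions is the
    dimension of the space, and the numerator of f - g would have more zeros
    than its degree allows. *)
Lemma laurent_poly_uniq m (x : 'I_m -> K) (nu : 'I_m -> nat) d f g :
  injective x -> (forall k, x k != 0) ->
  laurent_poly d (\sum_(k < m) nu k) f -> laurent_poly d (\sum_(k < m) nu k) g ->
  (forall k s, (s < nu k)%N -> f^`(s)%classic (x k) = g^`(s)%classic (x k)) ->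
  forall z, z != 0 -> f z = g z.
Proof.
move=> x_inj x_neq0 fL gL fg z z_neq0; apply/eqP; rewrite -subr_eq0; apply/eqP.
have [q szq fgq] := laurent_polyB fL gL.
rewrite fgq // (poly_eq0_of_zeros x_inj szq) ?horner0 ?mul0r // => k.
apply/(dvdp_exp_XsubCP _ (x_neq0 k) fgq) => s s_lt.
by rewrite (derive1n_laurentB s (x_neq0 k) fL gL) fg // subrr.
Qed.

End PolynomialOverPower.

(** * The Lagrange-Laurent basis *)

Section Basis.
Variables (R : realType).
Local Notation K := (CC R).

(** The spans of monomials with integer exponents, as numerators over z ^ d;
    the exponent - d + i of a monomial corresponds to the coefficient of index
    i of the numerator. *)
Lemma laurentP (d N : nat) (b : int) (f : K -> K) : b = N%:Z - d%:Z ->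
  laurent (- d%:Z) b f <-> laurent_poly d N.+1 f.
Proof.
move=> ->.
have z_exp (z : K) (i : nat) : z != 0 -> z ^ (- d%:Z + i%:Z) = z ^+ i / z ^+ d.
  by move=> z_neq0; rewrite expfzDr // mulrC exprnN exprnP.
have -> : laurent (- d%:Z) (N%:Z - d%:Z) f <-> exists c : int -> K,
    forall z : K, z != 0 -> f z = \sum_(i < N.+1) c (- d%:Z + i%:Z) * z ^ (- d%:Z + i%:Z).
  rewrite /laurent opprK subrK absz_nat.
  split=> -[c fc]; exists c => z z_neq0; rewrite fc //; [|symmetry]; apply: eq_bigl => i;
  by rewrite addrC lerD2r lez_nat -ltnS ltn_ord.
split=> [[c fc]|[q szq fq]].
  exists (\poly_(i < N.+1) c (- d%:Z + i%:Z)); first exact: size_poly.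
  move=> z z_neq0; rewrite fc // horner_poly mulr_suml.
  by apply: eq_bigr => i _; rewrite z_exp // mulrA.
exists (fun j => q`_(absz (j + d%:Z))) => z z_neq0.
rewrite fq // (horner_coef_wide z szq) mulr_suml; apply: eq_bigr => i _.
by rewrite z_exp // mulrA addrAC addNr add0r.
Qed.

Variables (m : nat) (zt : 'I_m -> K) (nu : 'I_m -> nat) (p : nat).
Hypothesis zt_neq0 : forall k, zt k != 0.
Hypothesis zt_inj : injective zt.
Local Notation r := (\sum_(k < m) nu k)%N.

(** The numerator of ell_(k,l) without the factor (X - z_k) ^ l / l!, which is
    the same for all l and does not vanish at z_k. *)
Definition ell_cofactor (k : 'I_m) : {poly K} :=
  zt k ^+ p *: \prod_(j < m | j != k)
     ((zt k - zt j) ^- nu j *: ('X - (zt j)%:P) ^+ nu j).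

Lemma ell_cofactor_node k : (ell_cofactor k).[zt k] = zt k ^+ p.
Proof.
rewrite /ell_cofactor hornerZ horner_prod big1 ?mulr1 // => j jk.
rewrite hornerZ horner_exp hornerXsubC mulVf // expf_neq0 // subr_eq0.
by rewrite inj_eq // eq_sym.
Qed.

Definition ell_num k l : {poly K} :=
  l`!%:R^-1 *: (('X - (zt k)%:P) ^+ l * ell_cofactor k).

Lemma ell_frac_poly k l : frac_poly p (ell_num k l) (ell zt nu p k l).
Proof.
move=> z z_neq0; rewrite /ell /ell_num /ell_cofactor.
rewrite !(hornerZ, hornerM, horner_exp, hornerXsubC) horner_prod expr_div_n.
rewrite [in RHS](eq_bigr (fun j => ((z - zt j) / (zt k - zt j)) ^+ nu j)).
  by ring.
by move=> j _; rewrite hornerZ horner_exp hornerXsubC expr_div_n mulrC.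
Qed.

Lemma size_ell_num k l : (size (ell_num k l) <= (l + (r - nu k)).+1)%N.
Proof.
rewrite (leq_trans (size_scale_leq _ _)) //.
rewrite (leq_trans (size_polyMleq _ _)) // size_exp_XsubC /=.
rewrite -addnS leq_add2l (leq_trans (size_scale_leq _ _)) //.
rewrite scaler_prod (leq_trans (size_scale_leq _ _)) // size_prod_exp_XsubC.
by rewrite ltnS [in leqRHS](bigD1 k) //= addKn.
Qed.

Lemma ell_laurent_poly k l : laurent_poly p (l + (r - nu k)).+1 (ell zt nu p k l).
Proof. exists (ell_num k l); [exact: size_ell_num|exact: ell_frac_poly]. Qed.

(** The factor (z - z_k) ^ l / l! decides all derivatives of order at most l at
    z_k, since the other factors are 1 at z_k. *)
Lemma derive1n_ell_node k l s : (s <= l)%N ->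
  derive1n s (ell zt nu p k l) (zt k) = (s == l)%:R.
Proof.
have fq := @ell_frac_poly k l.
rewrite leq_eqVlt => /orP[/eqP ->|s_lt_l].
  rewrite eqxx; move: fq; rewrite /ell_num scalerAr => fq.
  rewrite (frac_poly_derive1n_at_zero (zt_neq0 k) fq) hornerZ ell_cofactor_node.
  by rewrite mulrA divff ?mul1r ?divff ?expf_neq0.
rewrite ltn_eqF //; move: s s_lt_l; apply/(dvdp_exp_XsubCP _ (zt_neq0 k) fq).
by rewrite /ell_num scalerAr dvdp_mulIl.
Qed.

Lemma derive1n_ell_other k l j s : j != k -> (s < nu j)%N ->
  derive1n s (ell zt nu p k l) (zt j) = 0.
Proof.
move=> jk; move: s; apply/(dvdp_exp_XsubCP _ (zt_neq0 j) (@ell_frac_poly k l)).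
have coef_neq0 i : i != k -> (zt k - zt i) ^- nu i != 0.
  by move=> ik; rewrite invr_eq0 expf_neq0 // subr_eq0 inj_eq // eq_sym.
rewrite /ell_num scalerAr dvdp_mull // !dvdpZr ?expf_neq0 //.
by rewrite (bigD1 j) //= dvdp_mulr // dvdpZr ?coef_neq0.
Qed.

Lemma nu_le_sum k : (nu k <= r)%N.
Proof. by rewrite (bigD1 k) //= leq_addr. Qed.

(** Biorthogonality of the basis to the derivatives at the nodes, by induction
    on nu k - l. Membership in the space has to be proved along with it, as
    differentiating the recursion termwise relies on it. *)
Lemma L_laurent_poly k l : (l < nu k)%N ->
  laurent_poly p r (L zt nu p k l) /\
  (forall j s, (s < nu j)%N ->
     derive1n s (L zt nu p k l) (zt j) = ((j == k) && (s == l))%:R).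
Proof.
move Ed : (nu k - l)%N => d; elim/ltn_ind: d l Ed => d IH l Ed l_lt.
have {}IH t : t \in index_iota l.+1 (nu k) -> laurent_poly p r (L zt nu p k t) /\
  (forall j s, (s < nu j)%N ->
     derive1n s (L zt nu p k t) (zt j) = ((j == k) && (s == t))%:R).
  rewrite mem_index_iota => /andP[lt_l t_lt].
  by apply: (IH (nu k - t)%N) => //; rewrite -Ed ltn_sub2l.
have ellL : laurent_poly p r (ell zt nu p k l).
  have [q szq fq] := ell_laurent_poly k l; exists q => //.
  apply: leq_trans szq _; rewrite -addSn.
  by rewrite (leq_trans (leq_add l_lt (leqnn _))) // subnKC // nu_le_sum.
have sumL := laurent_poly_sum (fun s => derive1n s (ell zt nu p k l) (zt k))
  (fun t tP => (IH t tP).1).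
rewrite LE //; split=> [|j s s_lt]; first exact: laurent_polyB.
rewrite (derive1n_laurentB s (zt_neq0 j) ellL sumL).
rewrite (derive1n_laurent_sum s _ (zt_neq0 j) (fun t tP => (IH t tP).1)).
rewrite big_seq (eq_bigr (fun t => derive1n t (ell zt nu p k l) (zt k) *
   ((j == k) && (s == t))%:R)); last by move=> t tP; rewrite (IH t tP).2.
rewrite -big_seq.
case: (eqVneq j k) s_lt => [->|jk] s_lt /=; last first.
  by rewrite derive1n_ell_other // big1 ?subr0 // => t _; rewrite mulr0.
(* Up to order l the correction contributes nothing; beyond, it is the
   corresponding derivative of ell itself. *)
have [s_le|s_gt] := leqP s l.
  rewrite derive1n_ell_node // big_seq big1 ?subr0 // => t.
  by rewrite mem_index_iota => /andP[lt _]; rewrite ltn_eqF ?mulr0 ?(leq_ltn_trans s_le).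
rewrite [s == l]gtn_eqF // (eq_bigr (fun t =>
  if t == s then derive1n t (ell zt nu p k l) (zt k) else 0)); last first.
  by move=> t _; rewrite eq_sym; case: eqP; rewrite ?mulr1 ?mulr0.
by rewrite -big_mkcond big_nat1_eq s_gt s_lt subrr.
Qed.

Lemma P_m_laurent_poly (zeta : forall k : 'I_m, 'I_(nu k) -> K) :
  laurent_poly p r (P_m zt p zeta) /\ interpolates zt zeta (P_m zt p zeta).
Proof.
pose inner k z := \sum_(l < nu k) zeta k l * L zt nu p k l z.
have LL k (l : 'I_(nu k)) := L_laurent_poly (ltn_ord l).
have innerL k : laurent_poly p r (inner k).
  by apply: laurent_poly_sum => l _; exact: (LL k l).1.
(* A coefficient 1 puts the outer sum in the form of a linear combination. *)
have P_mE : P_m zt p zeta = fun z => \sum_(k < m) 1 * inner k z.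
  by apply/funext => z; apply: eq_bigr => k _; rewrite mul1r.
rewrite P_mE; split=> [|k l]; first by apply: laurent_poly_sum => k _.
rewrite (derive1n_laurent_sum _ _ (zt_neq0 k) (fun j _ => innerL j)).
have inner_node j : derive1n l (inner j) (zt k) =
    \sum_(t < nu j) zeta j t * ((k == j) && (l == t :> nat))%:R.
  rewrite (derive1n_laurent_sum _ _ (zt_neq0 k) (fun t _ => (LL j t).1)).
  by apply: eq_bigr => t _; rewrite (LL j t).2.
rewrite (bigD1 k) //= big1 => [|j jk]; last first.
  rewrite mul1r inner_node big1 // => t _.
  by rewrite eq_sym (negPf jk) mulr0.
rewrite mul1r inner_node eqxx (bigD1 l) //= eqxx mulr1 big1 ?addr0 // => t tl.
by rewrite eq_sym val_eqE (negPf tl) mulr0.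
Qed.

End Basis.

Theorem theorem4 (R : realType) (m : nat) (hm : (1 <= m)%N)
    (zt : 'I_m -> CC R) (hT : forall k, `|zt k| = 1) (hinj : injective zt)
    (nu : 'I_m -> nat) (hnu : forall k, (0 < nu k)%N)
    (r : nat) (hr : r = (\sum_(k < m) nu k)%N)
    (p : nat) (hp : (p <= r - 1)%N)
    (zeta : forall k : 'I_m, 'I_(nu k) -> CC R) :
  (forall (k : 'I_m) (l : 'I_(nu k)),
     laurent (- p%:Z) (r%:Z + l%:Z - p%:Z - (nu k)%:Z) (ell zt nu p k l)) /\
  (forall (k : 'I_m) (l : 'I_(nu k)),
     laurent (- p%:Z) (r%:Z - p%:Z - 1) (L zt nu p k l)) /\
  (laurent (- p%:Z) (r%:Z - p%:Z - 1) (P_m zt p zeta) /\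
   interpolates zt zeta (P_m zt p zeta)) /\
  (forall Q : CC R -> CC R,
     laurent (- p%:Z) (r%:Z - p%:Z - 1) Q -> interpolates zt zeta Q ->
     forall z : CC R, z != 0 -> Q z = P_m zt p zeta z).
Proof.
have zt_neq0 k : zt k != 0 by rewrite -normr_eq0 hT oner_neq0.
have nu_le_r k : (nu k <= r)%N by rewrite hr nu_le_sum.
have r_gt0 : (0 < r)%N by rewrite (leq_trans (hnu (Ordinal hm))).
have laurent_rP f :
    laurent (- p%:Z) (r%:Z - p%:Z - 1) f <-> laurent_poly p r f.
  rewrite -[X in laurent_poly _ X](prednK r_gt0); apply: laurentP.
  by rewrite -[in LHS](prednK r_gt0) -addn1 PoszD; ring.
have [PL P_interp] := P_m_laurent_poly p zt_neq0 hinj zeta.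
rewrite -hr in PL.
split=> [k l|]; [|split=> [k l|]; [|split; [split=> //|]]].
- apply/(laurentP (N := l + (r - nu k))).
    by rewrite PoszD -subzn //; ring.
  by rewrite hr; exact: ell_laurent_poly.
- by apply/laurent_rP; rewrite hr; exact: (L_laurent_poly _ _ _ (ltn_ord l)).1.
- exact/laurent_rP.
move=> Q /laurent_rP QL Q_interp; rewrite hr in PL QL.
apply: laurent_poly_uniq hinj zt_neq0 QL PL _ => k s s_lt.
by rewrite (Q_interp k (Ordinal s_lt)) (P_interp k (Ordinal s_lt)).
Qed.
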